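(* Let $u$ be a positive integer, let $n\in\{4u-1,4u\}$, put $U=2n+1$, and define the sequence $(a_k)_{k\ge0}$ by \[ a_0=0,\qquad a_1=n+4u,\qquad a_{k+2}=2Ua_{k+1}-a_k+2n\quad(k\ge0). \] Then the positive integers $a$ for which $\{T_n,T_a\}$ is a $D(u^2)$-pair are precisely the integers $a_k$ with $k\ge1$. Moreover, $a_k>n$ for every $k\ge1$.
   Context: For a positive integer $m$, $T_m=m(m+1)/2$ denotes the $m$-th triangular number. For a nonzero integer $N$, a $D(N)$-pair is a set of two distinct positive integers whose product, increased by $N$, is a perfect square. *)

(* Defs.v *)
From mathcomp Require Import all_boot all_order all_algebra.

Set Implicit Arguments.
Unset Strict Implicit.
Unset Printing Implicit Defensive.

Import Order.TTheory GRing.Theory Num.Theory.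
Local Open Scope ring_scope.

(* The division is exact, since m * (m + 1) is even. *)
Definition triangular (m : int) : int := ((m * (m + 1)) %/ 2)%Z.

Definition perfect_square (m : int) : Prop := exists z : int, m = z ^+ 2.

(* [D_pair N x y] says that the set {x, y} is a D(N)-pair. *)
Definition D_pair (N x y : int) : Prop :=
  [/\ N != 0, 0 < x, 0 < y, x != y & perfect_square (x * y + N)].

(* The factor 2 * (2 * n + 1) is 2U, where U = 2n + 1. *)
Fixpoint aseq (u n : int) (k : nat) : int :=
  match k with
  | 0 => 0
  | k1.+1 =>
    match k1 with
    | 0 => n + 4 * u
    | k2.+1 => 2 * (2 * n + 1) * aseq u n k1 - aseq u n k2 + 2 * n
    end
  end.

(* Main.v *)
Require Import Defs.
From mathcomp Require Import all_boot all_order all_algebra.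
From mathcomp Require Import zify ring.

Set Implicit Arguments.
Unset Strict Implicit.
Unset Printing Implicit Defensive.

Import Order.TTheory GRing.Theory Num.Theory.
Local Open Scope ring_scope.

(** Put X = 2a + 1, U = 2n + 1 and D = n(n + 1). The pair condition
    T_n T_a + u^2 = z^2 is the Pell-type equation
    (4z)^2 - D X^2 = (4u)^2 - D, on which the unit U + 2 sqrt D acts.
    Since 4u is n or n + 1, dividing a solution with X > 1 by the unit makes
    |X| strictly smaller, so the descent ends at X = 1, z = u; the two
    signs of z there lie in the same orbit because U - 8u is 1 or -1. *)

Lemma triangularE (m : int) : 2 * triangular m = m * (m + 1).
Proof.
have h2 : (2 %| m * (m + 1))%Z.
  have [q [->|->]] : exists q : int, m = 2 * q \/ m = 2 * q + 1.
    by exists (m %/ 2)%Z; lia.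
  - by rewrite -mulrA dvdz_mulr.
  - have -> : (2 * q + 1) * (2 * q + 1 + 1) = 2 * ((2 * q + 1) * (q + 1)) by ring.
    by rewrite dvdz_mulr.
by rewrite mulrC /triangular divzK.
Qed.

(** Twice the pair condition, with [a * (a + 1)] standing for twice the triangular number, so that
    no division occurs. *)
Definition pell_eq (u t a z : int) : Prop :=
  2 * z ^+ 2 = t * (a * (a + 1)) + 2 * u ^+ 2.

(* Multiplication of 4z + (2a + 1) sqrt D by U + 2 sqrt D, where D = 2t. *)
Definition unit_step (n t : int) (p : int * int) : int * int :=
  ((2 * n + 1) * p.1 + n + 4 * p.2, (2 * n + 1) * p.2 + t * (2 * p.1 + 1)).

Definition orbit (u n t : int) (k : nat) : int * int :=
  iter k (unit_step n t) (0, u).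

Section PellOrbit.

Variables u n t : int.
Hypothesis u_gt0 : 0 < u.
Hypothesis n_u : n = 4 * u - 1 \/ n = 4 * u.
Hypothesis tE : 2 * t = n * (n + 1).

Let n_gt0 : 0 < n. Proof. by lia. Qed.

Let t_gt0 : 0 < t. Proof. by nia. Qed.

Lemma orbit_ge k : 0 <= (orbit u n t k).1 /\ u <= (orbit u n t k).2.
Proof.
elim: k => [|k [IHa IHz]]; first by split=> //=.
rewrite /orbit iterS -/(orbit u n t k) /unit_step /=.
by case: (orbit u n t k) IHa IHz => a z /= ha hz; split; nia.
Qed.

Lemma orbit_incr k : (orbit u n t k).1 + n < (orbit u n t k.+1).1.
Proof.
have [] := orbit_ge k; rewrite /orbit iterS -/(orbit u n t k) /unit_step /=.
by case: (orbit u n t k) => a z /= ha hz; nia.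
Qed.

Lemma orbit_gt k : n < (orbit u n t k.+1).1.
Proof. by have := orbit_incr k; have [] := orbit_ge k; lia. Qed.

(** Eliminating the second coordinate from two consecutive steps yields the recurrence, because the
    unit has trace 2U and norm 1. *)
Lemma orbit_aseq k : (orbit u n t k).1 = aseq u n k.
Proof.
suff [] : (orbit u n t k).1 = aseq u n k /\
          (orbit u n t k.+1).1 = aseq u n k.+1 by [].
elim: k => [|k [IH0 IH1]]; first by split=> //=; ring.
split=> //.
rewrite [aseq u n k.+2]/= -/(aseq u n k.+1) -IH1 -IH0.
rewrite /orbit !iterS -/(orbit u n t k) /unit_step /=.
case: (orbit u n t k) => a z /=.
apply/eqP; rewrite -subr_eq0; apply/eqP.
transitivity ((2 * t - n * (n + 1)) * (2 * (2 * a + 1))); first by ring.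
by rewrite tE subrr mul0r.
Qed.

(** The unit has norm U^2 - 4D = 1, so multiplying by it preserves (4z)^2 - D(2a + 1)^2. *)
Lemma pell_eq_step a z : pell_eq u t a z ->
  pell_eq u t (unit_step n t (a, z)).1 (unit_step n t (a, z)).2.
Proof.
rewrite /pell_eq /unit_step /= => h; apply/eqP; rewrite -subr_eq0; apply/eqP.
transitivity ((2 * z ^+ 2 - (t * (a * (a + 1)) + 2 * u ^+ 2)) +
  (2 * t - n * (n + 1)) * (t * (2 * a + 1) ^+ 2 - 8 * z ^+ 2)).
  ring.
by rewrite tE h !subrr mul0r addr0.
Qed.

Lemma pell_eq_opp a z : pell_eq u t a (- z) = pell_eq u t a z.
Proof. by rewrite /pell_eq sqrrN. Qed.

Lemma pell_eq_orbit k : pell_eq u t (orbit u n t k).1 (orbit u n t k).2.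
Proof.
elim: k => [|k]; first by rewrite /pell_eq /=; ring.
rewrite /orbit iterS -/(orbit u n t k).
by case: (orbit u n t k) => a z; apply: pell_eq_step.
Qed.

(** A unit of norm 1 has its conjugate as inverse, so division by it is a step between two sign
    changes of z. *)
Lemma unit_stepK a z :
  let p := unit_step n t (a, - z) in unit_step n t (p.1, - p.2) = (a, z).
Proof.
rewrite /unit_step /=; congr pair; apply/eqP; rewrite -subr_eq0; apply/eqP.
  transitivity (- (2 * t - n * (n + 1)) * (2 * (2 * a + 1))); first by ring.
  by rewrite tE subrr oppr0 mul0r.
transitivity (- (2 * t - n * (n + 1)) * (4 * z)); first by ring.
by rewrite tE subrr oppr0 mul0r.
Qed.

(** The reflection negates 4z + (2a + 1) sqrt D, and negation commutes with multiplication by the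
    unit. *)
Lemma unit_step_reflect a z : unit_step n t (- 1 - a, - z) =
  (- 1 - (unit_step n t (a, z)).1, - (unit_step n t (a, z)).2).
Proof. by rewrite /unit_step /=; congr pair; ring. Qed.

(* That is, |2a + 1| decreases strictly under division by the unit. *)
Lemma pell_descent (a z : int) : 0 < a -> 0 <= z -> pell_eq u t a z ->
  - 1 - a < (unit_step n t (a, - z)).1 < a.
Proof.
move=> a_gt0 z_ge0; rewrite /pell_eq /unit_step /= => h.
have h16 : (4 * z) ^+ 2 = 4 * (n * (n + 1)) * (a * (a + 1)) + (4 * u) ^+ 2.
  by rewrite -tE; move: h; rewrite !expr2; lia.
have a1_gt0 : 0 < a + 1 by lia.
have aa_gt0 : 0 < a * (a + 1) by rewrite mulr_gt0.
have na_gt0 : 0 < n * (a * (a + 1)) by rewrite mulr_gt0.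
have u_n : 4 * u = n + 1 \/ 4 * u = n by lia.
(* [lo] and [hi] are the two claimed inequalities rearranged. After squaring they follow from n <=
   4u <= n + 1 and [aa_gt0]. *)
have lo : n * (2 * a + 1) < 4 * z.
  rewrite -(@ltr_pXn2r _ 2) ?nnegrE //; [|by rewrite mulr_ge0; lia|by lia].
  by rewrite h16 !expr2; case: u_n => ->; lia.
have hi : 4 * z < (n + 1) * (2 * a + 1).
  rewrite -(@ltr_pXn2r _ 2) ?nnegrE //; [|by lia|by rewrite mulr_ge0; lia].
  by rewrite h16 !expr2; case: u_n => ->; lia.
by apply/andP; split; lia.
Qed.

(* A step applied to the conjugate (a, - z) moves back along the orbit; at
   k = 0 it gives a = n - 4u, which is -1 or 0. *)
Lemma unit_step_conj_orbit k :
  (unit_step n t ((orbit u n t k).1, - (orbit u n t k).2)).1 <=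
    (orbit u n t k).1 /\
  - 1 <= (unit_step n t ((orbit u n t k).1, - (orbit u n t k).2)).1.
Proof.
case: k => [|k]; first by rewrite /unit_step /=; lia.
have -> : unit_step n t ((orbit u n t k.+1).1, - (orbit u n t k.+1).2) =
          ((orbit u n t k).1, - (orbit u n t k).2).
  have := unit_stepK (orbit u n t k).1 (- (orbit u n t k).2).
  by rewrite opprK -surjective_pairing.
by have := orbit_incr k; have [] := orbit_ge k => /=; lia.
Qed.

Lemma pell_eq_in_orbit (a z : int) : 0 <= a -> 0 <= z -> pell_eq u t a z ->
  exists k, orbit u n t k = (a, z).
Proof.
move: {2}`|a|%N.+1 (ltnSn `|a|%N) => N.
elim: N a z => [|N IH] a z; first by lia.
move=> aN a_ge0 z_ge0 h.
have [a0|a_neq0] := eqVneq a 0.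
  exists 0%N; rewrite /orbit /= a0; congr pair.
  by move: h; rewrite /pell_eq a0 !expr2; nia.
have a_gt0 : 0 < a by lia.
have := pell_descent a_gt0 z_ge0 h.
have h' : pell_eq u t a (- z) by rewrite pell_eq_opp.
have := pell_eq_step h'.
have := unit_stepK a z; cbv zeta.
case: (unit_step n t (a, - z)) => b w /= E hb /andP[b_lo b_hi].
case: (leP 0 b) => b_sign; case: (leP 0 w) => w_sign.
(* Of the four sign patterns only [b >= 0], [w < 0] can occur. Here [(b, w)] would be an orbit point
   whose conjugate steps to [(a, z)], which forces [a <= b]. *)
- have [k Ek] := IH b w ltac:(lia) b_sign w_sign hb.
  by have [] := unit_step_conj_orbit k; rewrite Ek E /=; lia.
- rewrite -pell_eq_opp in hb.
  have [k Ek] := IH b (- w) ltac:(lia) b_sign ltac:(lia) hb.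
  by exists k.+1; rewrite /orbit iterS -/(orbit u n t k) Ek.
(* With [b <= -1] and [w >= 0], stepping from [(b, - w)] gives a negative [a]. *)
- by move: E; rewrite /unit_step /= => -[E _]; nia.
- have hb' : pell_eq u t (- 1 - b) (- w).
    by move: hb; rewrite /pell_eq => hb; rewrite sqrrN hb; ring.
  have [k Ek] := IH (- 1 - b) (- w) ltac:(lia) ltac:(lia) ltac:(lia) hb'.
  (* The conjugate of the reflected orbit point steps to first coordinate [- 1 - a]; the lower bound
     [- 1] then gives [a <= 0]. *)
  have [_] := unit_step_conj_orbit k.
  by rewrite Ek (unit_step_reflect b (- w)) E /=; lia.
Qed.

End PellOrbit.

Theorem mainTheorem3 (u n : int) (hu : 0 < u)
    (hn : n = 4 * u - 1 \/ n = 4 * u) :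
  (forall a : int,
     (0 < a /\ D_pair (u ^+ 2) (triangular n) (triangular a)) <->
     (exists k : nat, (1 <= k)%N /\ a = aseq u n k)) /\
  (forall k : nat, (1 <= k)%N -> n < aseq u n k).
Proof.
have tE := triangularE n; set t := triangular n in tE *.
have gt_n k : (1 <= k)%N -> n < aseq u n k.
  by case: k => // k _; rewrite -(orbit_aseq u tE); apply: orbit_gt.
have pellE a z :
    t * triangular a + u ^+ 2 = z ^+ 2 <-> pell_eq u t a z.
  by rewrite /pell_eq -triangularE; split; lia.
split=> // a; split.
  move=> [a_gt0 [_ _ _ _ [z hz]]].
  have /pellE hpell : t * triangular a + u ^+ 2 = `|z| ^+ 2.
    by rewrite hz real_normK ?num_real.
  have [k Ek] := pell_eq_in_orbit hu hn tE (ltW a_gt0) (normr_ge0 z) hpell.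
  exists k; rewrite -(orbit_aseq u tE) Ek; split=> //.
  by case: k Ek => // -[a0 _]; rewrite -a0 ltxx in a_gt0.
move=> [k [k_gt0 ->]].
have := gt_n k k_gt0; have := pell_eq_orbit u tE k.
rewrite (orbit_aseq u tE); move: (aseq u n k) => {}a /pellE hz a_gt.
have aE := triangularE a.
split; first by lia.
split; [by nia|by nia|by nia| |by exists (orbit u n t k).2].
(* Equal triangular numbers would give a(a + 1) = n(n + 1), contradicting [a > n > 0]. *)
by apply/eqP => ta; move: aE; rewrite -ta tE; nia.
Qed.
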